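(* Fix $\rho_r\in(0,1)$, $\rho_w\in(0,1/2)$ and $\epsilon>0$ with $\rho_r<1-h(\rho_w)-2\epsilon$. Let $C\subseteq\{0,1\}^n$ consist of $2^{Rn}$ independent uniformly random vectors, $R=1-h(\rho_w)-\epsilon$. Then with high probability over the choice of $C$, the following holds: when the transmitted codeword is chosen uniformly from $C$, for every adversary that reads an arbitrary set of $\rho_r n$ coordinates of the transmitted codeword and then adds an error vector of Hamming weight at most $\rho_w n$ whose distribution depends only on $C$ and the read symbols (with their positions), the probability that nearest-neighbor decoding of the received word does not return the transmitted codeword is $o(1)$ as $n\to\infty$.
   Context: $h$ is the binary entropy function. A decoding error is counted whenever the Hamming ball of radius $\rho_w n$ around the received word $x+e$ contains a codeword other than the transmitted $x$. *)

(* Defs.v *)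
From Stdlib Require Import Reals ClassicalDescription.
From mathcomp Require Import all_boot.

Set Implicit Arguments.
Unset Strict Implicit.
Unset Printing Implicit Defensive.
Local Open Scope R_scope.

(* Binary words of length n and codes (tuples of M codewords, chosen
   independently and uniformly, so possibly with repetitions). *)
Definition word (n : nat) := {ffun 'I_n -> bool}.
Definition code (n M : nat) := {ffun 'I_M -> word n}.

Definition wt n (e : word n) : nat := #|[set i | e i]|.
Definition hdist n (x y : word n) : nat := #|[set i | x i != y i]|.
Definition addw n (x e : word n) : word n := [ffun i => x i (+) e i].

Definition log2 (x : R) : R := Rdiv (ln x) (ln 2).
Definition h (p : R) : R := Rminus (Rmult (Ropp p) (log2 p)) (Rmult (Rminus 1 p) (log2 (Rminus 1 p))).

Definition ncode (Rate : R) (n : nat) : nat :=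
  Z.to_nat (Int_part (Rpower 2 (Rate * INR n))).

Definition pbool (P : Prop) : bool :=
  if excluded_middle_informative P then true else false.

Definition dec_err n M (rw : R) (C : code n M) (i : 'I_M) (e : word n) : bool :=
  [exists j, (C j != C i) &&
     (if Rle_dec (INR (hdist (C j) (addw (C i) e))) (rw * INR n) then true
      else false)].

(* An adversary reading the coordinates in S: for each (true) transmitted word
   x, A x is a probability distribution on error vectors of weight <= rw n,
   depending on x only through its restriction to S (A may depend on C and S
   arbitrarily, since it is quantified after them). *)
Definition adversary n (rw : R) (S : {set 'I_n}) (A : word n -> word n -> R)
  : Prop :=
  (forall x e, 0 <= A x e) /\
  (forall x, \big[Rplus/0]_(e : word n) A x e = 1) /\
  (forall x e, (0 < A x e) -> (INR (wt e) <= rw * INR n)) /\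
  (forall x y : word n, (forall i, i \in S -> x i = y i) -> A x = A y).

Definition err_prob n M (rw : R) (C : code n M) (A : word n -> word n -> R) : R :=
  (\big[Rplus/0]_(i : 'I_M)
     \big[Rplus/0]_(e : word n)
        (A (C i) e * (if dec_err rw C i e then 1 else 0)) / INR M).

Definition good n M (rr rw d : R) (C : code n M) : Prop :=
  forall S : {set 'I_n}, (INR #|S| <= rr * INR n) ->
  forall A : word n -> word n -> R, adversary rw S A ->
  (err_prob rw C A <= d).

Definition prob_good (rr rw Rate : R) (n : nat) (d : R) : R :=
  (INR #|[set C : code n (ncode Rate n) | pbool (good rr rw d C)]|
   / INR #|{: code n (ncode Rate n)}|).

(* Main.v *)
Require Import Defs.
From Stdlib Require Import ZArith Reals Lra ClassicalDescription.
From HB Require Import structures.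
From mathcomp Require Import all_boot.
Open Scope R_scope.

(* Fix the read set S, a pattern v on S and an error vector e.  A codeword i
   showing the pattern v is decoded wrongly only if some j <> i has C j in the
   ball around C i + e; as i and j differ in one of their n binary digits, it
   suffices to treat the 2n pairs of index classes with i outside J and j in J.
   Two exponential-moment bounds do this: first, the balls around the words
   C j + e, j in J, cover at most 4 M 2^-|S| Vol words of the subcube of v
   (each ball contributes at most Vol, and M 2^-|S| >= 2^(eps n) / 2); second,
   given the C j, the remaining codewords are independent and fall in that set
   with probability at most 4 * 2^(-|S| - eps n), so fewer than
   M 2^-|S| 2^(-eps n / 2) of them do.  Both fail with doubly exponentially
   small probability, which beats the union bound over all S, v, e; averaging over
   v then bounds the error probability by 2 n 2^(-eps n / 2). *)

Set Implicit Arguments.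
Unset Strict Implicit.
Unset Printing Implicit Defensive.

(** * Finite sums and products of reals *)

HB.instance Definition _ := Monoid.isComLaw.Build R 0 Rplus
  (fun x y z => esym (Rplus_assoc x y z)) Rplus_comm Rplus_0_l.
HB.instance Definition _ := Monoid.isComLaw.Build R 1 Rmult
  (fun x y z => esym (Rmult_assoc x y z)) Rmult_comm Rmult_1_l.
HB.instance Definition _ := Monoid.isMulLaw.Build R 0 Rmult Rmult_0_l Rmult_0_r.
HB.instance Definition _ := Monoid.isAddLaw.Build R Rmult Rplus
  Rmult_plus_distr_r Rmult_plus_distr_l.

Definition indic (b : bool) : R := if b then 1 else 0.

Lemma indic_ge0 b : 0 <= indic b.
Proof. rewrite /indic; case: b; lra. Qed.

Lemma pboolP (P : Prop) : reflect P (pbool P).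
Proof.
by rewrite /pbool; case: excluded_middle_informative => p; constructor.
Qed.

Lemma leR_sum (I : Type) (s : seq I) (P : pred I) (F G : I -> R) :
  (forall i, P i -> F i <= G i) ->
  \big[Rplus/0]_(i <- s | P i) F i <= \big[Rplus/0]_(i <- s | P i) G i.
Proof.
by move=> le; elim/big_ind2: _ => //; [lra | move=> *; apply: Rplus_le_compat].
Qed.

Lemma sumR_ge0 (I : Type) (s : seq I) (P : pred I) (F : I -> R) :
  (forall i, P i -> 0 <= F i) -> 0 <= \big[Rplus/0]_(i <- s | P i) F i.
Proof. by move=> ge; elim/big_ind: _ => //; [lra | move=> *; lra]. Qed.

Lemma prodR_ge0 (I : Type) (s : seq I) (F : I -> R) :
  (forall i, 0 <= F i) -> 0 <= \big[Rmult/1]_(i <- s) F i.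
Proof.
by move=> ge; elim/big_ind: _ => //; [lra | exact: Rmult_le_pos].
Qed.

Lemma leR_prod (I : Type) (s : seq I) (F G : I -> R) :
  (forall i, 0 <= F i <= G i) ->
  \big[Rmult/1]_(i <- s) F i <= \big[Rmult/1]_(i <- s) G i.
Proof.
move=> le; elim: s => [|x s ih]; rewrite ?big_nil ?big_cons; first lra.
have [? ?] := le x; apply: Rmult_le_compat => //.
by apply: prodR_ge0 => i; case: (le i).
Qed.

Lemma sumR_const (I : finType) (P : pred I) (c : R) :
  \big[Rplus/0]_(i | P i) c = INR #|P| * c.
Proof.
rewrite big_const; elim: #|P| => [|k ih]; first by rewrite Rmult_0_l.
by rewrite iterS ih S_INR; lra.
Qed.

Lemma prodR_const (I : finType) (c : R) :
  \big[Rmult/1]_(i : I) c = c ^ #|I|.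
Proof.
by rewrite big_const; elim: #|_| => //= k ->.
Qed.

Lemma sumR_indic (I : finType) (P Q : pred I) :
  \big[Rplus/0]_(i | P i) indic (Q i) = INR #|[pred i | P i && Q i]|.
Proof.
rewrite /indic -big_mkcondr -[RHS]Rmult_1_r -(@sumR_const I) //.
Qed.

Lemma card_indic (I : finType) (A : mem_pred I) :
  INR (card A) = \big[Rplus/0]_(i : I) indic (in_mem i A).
Proof. by rewrite /indic -big_mkcond sumR_const Rmult_1_r; case: A. Qed.

Lemma exp_sum (I : Type) (s : seq I) (F : I -> R) :
  exp (\big[Rplus/0]_(i <- s) F i) = \big[Rmult/1]_(i <- s) exp (F i).
Proof. exact: (big_morph exp exp_plus exp_0). Qed.

Lemma exp_le x y : x <= y -> exp x <= exp y.
Proof. by case=> [/exp_increasing|->]; lra. Qed.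

Lemma INR_expn m k : INR (expn m k) = INR m ^ k.
Proof. by elim: k => //= k <-; rewrite expnS mult_INR. Qed.

(** The convention [/ 0 = 0] covers [k = 0], so the comparisons of [prob] below hold over an empty
    type too. *)
Lemma Rinv_INR_ge0 k : 0 <= / INR k.
Proof.
have [->|k0] := Req_dec (INR k) 0; first by rewrite Rinv_0; lra.
by apply/Rlt_le/Rinv_0_lt_compat; have := pos_INR k; lra.
Qed.

(** * Uniform probability, exponential moments and decoupling *)

Definition prob (T : finType) (A : {set T}) : R := INR #|A| / INR #|T|.

Section Probability.
Variable T : finType.
Implicit Types A B : {set T}.

Lemma prob_sub A B : A \subset B -> prob A <= prob B.
Proof.
move=> sAB; apply: Rmult_le_compat_r; first exact: Rinv_INR_ge0.
exact/le_INR/leP/subset_leq_card.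
Qed.

Lemma prob_union_bound (K : finType) A (B : K -> {set T}) (c : R) :
  (forall x, x \in A -> exists k, x \in B k) -> (forall k, prob (B k) <= c) ->
  prob A <= INR #|K| * c.
Proof.
move=> cov leB.
have -> : INR #|K| * c = \big[Rplus/0]_(k : K) c by rewrite sumR_const.
apply: Rle_trans (leR_sum _ (fun k _ => leB k)).
rewrite /prob /Rdiv -(@big_distrl _ _ Rmult Rplus) /=.
apply: Rmult_le_compat_r; first exact: Rinv_INR_ge0.
rewrite card_indic.
rewrite (eq_bigr _ (fun k _ => card_indic (mem (B k)))) /=.
rewrite exchange_big /=; apply: leR_sum => x _.
rewrite {1}/indic; case: ifP => [/cov[k xk]|_]; last first.
  by apply: sumR_ge0 => k _; exact: indic_ge0.
rewrite (bigD1 k) //= xk.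
suff: 0 <= \big[Rplus/0]_(i | i != k) indic (x \in B i).
  by rewrite {2}/indic; lra.
by apply: sumR_ge0 => i _; exact: indic_ge0.
Qed.

Lemma prob_setU A B : prob (A :|: B) <= prob A + prob B.
Proof.
rewrite /prob /Rdiv -Rmult_plus_distr_r -plus_INR.
apply: Rmult_le_compat_r; first exact: Rinv_INR_ge0.
by apply/le_INR/leP; rewrite cardsU; exact: leq_subr.
Qed.

Lemma prob_setC A : (0 < #|T|)%N -> prob A = 1 - prob (~: A).
Proof.
move=> T0; rewrite /prob.
have e : INR #|T| = INR #|A| + INR #|~: A|.
  by rewrite -plus_INR; congr INR; exact/esym/cardsC.
have : 0 < INR #|T| by exact/lt_0_INR/ltP.
by rewrite e => ?; field; lra.
Qed.

End Probability.

(** From [exp (- y / 2) >= 1 - y / 2] and [(1 + y) (1 - y / 2) >= 1] on the unit interval. *)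
Lemma exp_half_le y : 0 <= y <= 1 -> exp (y / 2) <= 1 + y.
Proof.
move=> y01; have e1 := exp_ineq1_le (- (y / 2)).
have p := exp_pos (y / 2).
have e2 : exp (y / 2) * exp (- (y / 2)) = 1.
  by rewrite -exp_plus Rplus_opp_r exp_0.
have : exp (y / 2) * (1 - y / 2) <= 1 by rewrite -e2; nra.
nra.
Qed.

(** Markov's inequality for the exponential moment with parameter 1/2: each factor has mean at most
    [1 + m <= exp m]. *)
Lemma chernoff (I T : finType) (f : I -> T -> R) (m t : R) :
  (0 < #|T|)%N -> (forall i x, 0 <= f i x <= 1) ->
  (forall i, \big[Rplus/0]_(x : T) f i x <= m * INR #|T|) ->
  prob [set C : {ffun I -> T} | pbool (t <= \big[Rplus/0]_(i : I) f i (C i))]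
    <= exp (INR #|I| * m - t / 2).
Proof.
move=> T0 f01 fm.
have T0R : 0 < INR #|T| by apply/lt_0_INR/ltP.
rewrite /prob card_ffun INR_expn.
have powT := pow_lt _ #|I| T0R.
apply: (Rmult_le_reg_r (INR #|T| ^ #|I|)) => //.
rewrite /Rdiv Rmult_assoc Rinv_l; last lra.
rewrite Rmult_1_r -/(Rdiv t 2) card_indic.
(* The indicator of the event is at most [exp ((sum - t) / 2)]. *)
apply: Rle_trans (_ : \big[Rplus/0]_(C : {ffun I -> T})
    (exp (- (t / 2)) * \big[Rmult/1]_(i : I) exp (f i (C i) / 2)) <= _).
  apply: leR_sum => C _; rewrite -exp_sum -exp_plus /indic inE.
  case: pboolP => [le|_]; last exact/Rlt_le/exp_pos.
  rewrite -exp_0; apply: exp_le.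
  have -> : \big[Rplus/0]_(i : I) (f i (C i) / 2)
      = \big[Rplus/0]_(i : I) f i (C i) / 2.
    by rewrite /Rdiv (@big_distrl _ _ Rmult Rplus).
  lra.
rewrite -(@big_distrr _ _ Rmult Rplus) /=.
(* Independence of the coordinates: summing a product over all functions gives the product of the
   sums. *)
rewrite -(bigA_distr_bigA (times := Rmult) (plus := Rplus)
  (fun i x => exp (f i x / 2))) /=.
apply: Rle_trans (_ : exp (- (t / 2)) * (exp m * INR #|T|) ^ #|I| <= _).
  apply: Rmult_le_compat_l; first exact/Rlt_le/exp_pos.
  rewrite -prodR_const; apply: leR_prod => i; split.
    by apply: sumR_ge0 => x _; exact/Rlt_le/exp_pos.
  apply: Rle_trans (_ : \big[Rplus/0]_(x : T) (1 + f i x) <= _).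
    by apply: leR_sum => x _; exact: exp_half_le.
  rewrite big_split /= sumR_const Rmult_1_r.
  have -> : #|(fun _ : T => true)| = #|T| by [].
  have := fm i; have := exp_ineq1_le m; nra.
rewrite Rpow_mult_distr; right.
have -> : exp m ^ #|I| = exp (INR #|I| * m).
  elim: #|I| => [|k ih]; first by rewrite Rmult_0_l exp_0.
  by rewrite S_INR /= ih -exp_plus; congr exp; ring.
by rewrite -Rmult_assoc -exp_plus Rplus_comm.
Qed.

(* Swapping the J-coordinates of a pair (C, D) is an involution, so the
   diagonal event is as likely as its version with an independent copy D. *)
Lemma prob_decouple (I T : finType) (J : {set I})
    (Q : {ffun I -> T} -> {ffun I -> T} -> bool) (c : R) :
  (0 < #|T|)%N ->
  (forall C C' D D' : {ffun I -> T}, (forall i, i \notin J -> C i = C' i) ->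
    (forall i, i \in J -> D i = D' i) -> Q C D = Q C' D') ->
  (forall D, prob [set C | Q C D] <= c) ->
  prob [set C | Q C C] <= c.
Proof.
case/card_gt0P=> x0 _ Qdep leQ; pose F : finType := {ffun I -> T}.
pose mix (C D : F) : F := [ffun i => if i \in J then D i else C i].
pose swap (p : F * F) := (mix p.1 p.2, mix p.2 p.1).
have swapK : involutive swap.
  case=> C D; rewrite /swap /=.
  by congr pair; apply/ffunP => i; rewrite !ffunE; case: (i \in J).
have F0 : 0 < INR #|F| by apply/lt_0_INR/ltP/card_gt0P; exists [ffun=> x0].
have diag : INR #|F| * INR #|[set C : F | Q C C]|
    = \big[Rplus/0]_(D : F) INR #|[set C : F | Q C D]|.
  have -> : INR #|F| * INR #|[set C : F | Q C C]|
      = \big[Rplus/0]_(p : F * F) indic (Q p.1 p.1).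
    rewrite -(pair_bigA _ (fun C _ : F => indic (Q C C))) exchange_big /=.
    rewrite sumR_const (card_indic (mem [set C | Q C C])); congr (_ * _).
    by apply: eq_bigr => C _; rewrite in_set.
  rewrite [RHS](eq_bigr _ (fun D _ => card_indic (mem [set C | Q C D]))) /=.
  rewrite exchange_big pair_bigA /= (reindex_inj (inv_inj swapK)) /=.
  apply: eq_bigr => -[C D] _; rewrite in_set /=; congr indic.
  by apply: Qdep => i iJ; rewrite ffunE ?iJ // (negbTE iJ).
have := @leR_sum F (index_enum _) xpredT _ _ (fun D _ => leQ D).
rewrite /prob /Rdiv -(@big_distrl _ _ Rmult Rplus) /= -diag sumR_const.
have -> : #|(fun _ : F => true)| = #|F| by [].
move=> le; apply: (Rmult_le_reg_l (INR #|F|)) => //.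
by rewrite -Rmult_assoc.
Qed.

(** * Words, subcubes and Hamming balls *)

Section Words.
Variable n : nat.
Implicit Types (x y z v e : word n) (S : {set 'I_n}).

Lemma addwK y : involutive (fun x => addw x y).
Proof. by move=> x; apply/ffunP => i; rewrite !ffunE addbK. Qed.

Lemma hdistE x y : hdist x y = wt (addw x y).
Proof. by apply: eq_card => i; rewrite !inE ffunE; do 2!case: (_ i). Qed.

Lemma INR_card_word : INR #|{: word n}| = 2 ^ n.
Proof. by rewrite card_ffun card_bool card_ord INR_expn. Qed.

Definition agree S x y : bool := [forall i in S, x i == y i].

Lemma agree_sym S x y : agree S x y = agree S y x.
Proof. by apply: eq_forallb => i; rewrite eq_sym. Qed.

Lemma card_agree S v :
  \big[Rplus/0]_(x : word n) indic (agree S v x) = 2 ^ #|~: S|.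
Proof.
rewrite sumR_indic.
transitivity (INR #|finfun.family
    (fun i => if i \in S then pred1 (v i) else predT)|).
  congr INR; apply: eq_card => x.
  apply/forall_inP/familyP => /= [eqx i | fam i iS].
    case: ifP => // /eqx; rewrite !inE => /eqP ->; exact: eqxx.
  by have := fam i; rewrite iS inE eq_sym.
rewrite card_family foldrE big_map big_enum /=.
rewrite (eq_bigr (fun i => if i \in ~: S then 2%N else 1%N)); last first.
  by move=> i _; rewrite inE; case: (i \in S); rewrite ?card1 ?card_bool.
by rewrite -big_mkcond prod_nat_const INR_expn.
Qed.

Definition light (r : R) z : bool :=
  if Rle_dec (INR (wt z)) r then true else false.

Lemma lightP r z : reflect (INR (wt z) <= r) (light r z).
Proof. by rewrite /light; case: Rle_dec => ?; constructor. Qed.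

Definition vol (r : R) : R := \big[Rplus/0]_(z : word n) indic (light r z).

Lemma vol_ball r c :
  \big[Rplus/0]_(x : word n) indic (light r (addw x c)) = vol r.
Proof. by rewrite [RHS](reindex_inj (inv_inj (addwK c))). Qed.

Lemma vol_ge1 r : 0 <= r -> 1 <= vol r.
Proof.
move=> r0; rewrite /vol (bigD1 [ffun=> false]) //=.
have -> : light r [ffun=> false].
  apply/lightP; suff -> : wt ([ffun=> false] : word n) = 0%N by [].
  by apply/eqP; rewrite cards_eq0; apply/eqP/setP => i; rewrite !inE ffunE.
set s := \big[_/_]_(_ | _) _; suff : 0 <= s by rewrite /indic; lra.
by apply: sumR_ge0 => i _; exact: indic_ge0.
Qed.

(** This is 2^-|S|, the probability that a uniform word shows a given pattern on [S]. Patterns are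
    represented by full words [v], of which only the values on [S] matter. *)
Definition density S : R := 2 ^ #|~: S| / 2 ^ n.

(** The part of the ball around [x + e] that lies in the subcube of [v], measured in units of a full
    ball so that [chernoff] applies to it. *)
Definition cover r S v e x : R :=
  \big[Rplus/0]_(y : word n) indic (agree S v y && light r (addw x (addw y e)))
  / vol r.

Lemma cover_ge0_le1 r S v e x : 0 <= r -> 0 <= cover r S v e x <= 1.
Proof.
move=> r0; have vol1 := vol_ge1 r0; split.
  apply: Rmult_le_pos; last by apply/Rlt_le/Rinv_0_lt_compat; lra.
  by apply: sumR_ge0 => y _; exact: indic_ge0.
apply: (Rmult_le_reg_r (vol r)); first lra.
rewrite /cover /Rdiv Rmult_assoc Rinv_l ?Rmult_1_l ?Rmult_1_r; last lra.
rewrite -(vol_ball r (addw x e)); apply: leR_sum => y _.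
have -> : addw x (addw y e) = addw y (addw x e).
  by apply/ffunP => i; rewrite !ffunE addbCA.
by rewrite /indic; do 2![case: ifP => //]; case: agree => //= *; lra.
Qed.

(** Double counting: each word of the subcube lies in the balls of exactly [vol r] centres. *)
Lemma mean_cover r S v e : 0 <= r ->
  \big[Rplus/0]_(x : word n) cover r S v e x = 2 ^ #|~: S|.
Proof.
move=> r0; have vol1 := vol_ge1 r0.
rewrite /cover /Rdiv -(@big_distrl _ _ Rmult Rplus) /= exchange_big /=.
rewrite (eq_bigr (fun y => indic (agree S v y) * vol r)); last first.
  move=> y _; rewrite -(vol_ball r (addw y e)) (@big_distrr _ _ Rmult Rplus) /=.
  by apply: eq_bigr => x _; rewrite /indic; case: agree => /=; case: light; lra.
rewrite -(@big_distrl _ _ Rmult Rplus) /= card_agree Rmult_assoc.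
by rewrite Rinv_r ?Rmult_1_r //; lra.
Qed.

End Words.

(** * Tail bound for the hits between two index classes *)

(** The code enters twice, as [C] for the indices outside [J] and as [D] for those inside, so that
    [prob_decouple] can make the two roles independent. *)
Definition hit n M (r : R) (S : {set 'I_n}) (v e : word n) (J : {set 'I_M})
    (C D : code n M) (i : 'I_M) : bool :=
  [&& i \notin J, agree S v (C i)
    & [exists j in J, light r (addw (D j) (addw (C i) e))]].

(** The first term bounds the event that the coverage by [J] reaches [s], the second the event that
    it stays below [s] and still [t] hits occur. *)
Lemma hit_tail n M (r : R) (S : {set 'I_n}) (v e : word n) (J : {set 'I_M})
    (s t : R) : 0 <= r ->
  prob [set C : code n M |
      pbool (t <= \big[Rplus/0]_(i : 'I_M) indic (hit r S v e J C C i))]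
    <= exp (INR M * density S - s / 2)
       + exp (INR M * (s * vol n r / 2 ^ n) - t / 2).
Proof.
move=> r0.
have T0 : (0 < #|{: word n}|)%N by apply/card_gt0P; exists [ffun=> false].
have IM : INR M = INR #|'I_M| by rewrite card_ord.
have pow2 : 0 < 2 ^ n by apply: pow_lt; lra.
have vol1 := @vol_ge1 n r r0.
pose f (j : 'I_M) x := if j \in J then cover r S v e x else 0.
pose cov (D : code n M) := \big[Rplus/0]_(j : 'I_M) f j (D j).
pose Q (C D : code n M) := ~~ pbool (s <= cov D)
  && pbool (t <= \big[Rplus/0]_(i : 'I_M) indic (hit r S v e J C D i)).
apply: Rle_trans (_ : prob [set D | pbool (s <= cov D)]
                      + prob [set C | Q C C] <= _).
  apply: Rle_trans (prob_setU _ _); apply: prob_sub.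
  by apply/subsetP => C; rewrite !inE /Q => ->; rewrite andbT orbN.
apply: Rplus_le_compat.
  rewrite IM; apply: chernoff => // [j x|j].
    by rewrite /f; case: ifP => _; [exact: cover_ge0_le1 | lra].
  apply: Rle_trans (_ : \big[Rplus/0]_(x : word n) cover r S v e x <= _).
    apply: leR_sum => x _; rewrite /f; case: ifP => _; first lra.
    by have [] := cover_ge0_le1 S v e x r0.
  by rewrite mean_cover // INR_card_word /density; right; field; lra.
apply: (@prob_decouple _ _ J) => // [C C' D D' eqC eqD|D].
  rewrite /Q; have -> : cov D = cov D'.
    by apply: eq_bigr => j _; rewrite /f; case: ifP => // /eqD ->.
  congr (_ && pbool (_ <= _)); apply: eq_bigr => i _; congr indic.
  rewrite /hit; case: (boolP (i \in J)) => //= iJ; rewrite eqC //.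
  by congr andb; apply: eq_existsb => j; case: (boolP (j \in J)) => //= /eqD ->.
(* With [D] fixed, the event is empty if its coverage is at least [s]; otherwise only [C] is
   random. *)
rewrite /Q; case: pboolP => [_|/Rnot_le_lt covD].
  rewrite (_ : [set _ | _] = set0); last by apply/setP => C; rewrite !inE.
  by rewrite /prob cards0 /Rdiv Rmult_0_l; exact/Rlt_le/exp_pos.
pose W x := [exists j in J, light r (addw (D j) (addw x e))].
rewrite IM.
apply: (@chernoff _ _ (fun (i : 'I_M) x =>
  indic [&& i \notin J, agree S v x & W x])) => //.
- by move=> i x; rewrite /indic; case: ifP; lra.
move=> i.
rewrite INR_card_word (_ : _ * 2 ^ n = s * vol n r); last by field; lra.
(* Union bound over [j]: the words that would produce a hit number at most the total size of the
   ball pieces in the subcube, which is [cov D * vol n r]. *)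
apply: Rle_trans (_ : cov D * vol n r <= _); last first.
  by apply: Rmult_le_compat_r; lra.
rewrite /cov (@big_distrl _ _ Rmult Rplus) /=.
have -> : \big[Rplus/0]_j (f j (D j) * vol n r) = \big[Rplus/0]_(x : word n)
    \big[Rplus/0]_(j in J)
      indic (agree S v x && light r (addw (D j) (addw x e))).
  rewrite exchange_big /= [RHS]big_mkcond; apply: eq_bigr => j _ /=.
  rewrite /f; case: ifP => _; last by rewrite Rmult_0_l.
  by rewrite /cover /Rdiv Rmult_assoc Rinv_l ?Rmult_1_r //; lra.
apply: leR_sum => x _; rewrite {1}/indic; case: ifP => [|_]; last first.
  by apply: sumR_ge0 => j _; exact: indic_ge0.
case/and3P => _ agr /exists_inP[j jJ lj]; rewrite (bigD1 j) //= agr lj.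
set u := \big[_/_]_(_ | _) _; suff : 0 <= u by rewrite /indic /=; lra.
by apply: sumR_ge0 => k _; exact: indic_ge0.
Qed.

(** * Separating indices by binary digits, and counting decoding errors *)

Definition bit_class M (b : nat) (beta : bool) : {set 'I_M} :=
  [set j : 'I_M | odd (j %/ expn 2 b) == beta].

Lemma eq_from_bits n (i j : nat) : (i < expn 2 n)%N -> (j < expn 2 n)%N ->
  (forall b, (b < n)%N -> odd (i %/ expn 2 b) = odd (j %/ expn 2 b)) -> i = j.
Proof.
elim: n i j => [|n ih] i j; first by case: i j => [|?] [|?].
rewrite expnSr => ltin ltjn eqb.
rewrite -(odd_double_half i) -(odd_double_half j); congr (_ + _.*2)%N.
  by have := eqb 0%N isT; rewrite expn0 !divn1 => ->.
rewrite -!divn2; apply: ih; rewrite ?ltn_divLR // => b ltbn.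
by rewrite -!divnMA -expnS; exact: eqb.
Qed.

Lemma bit_classes_separate n M (i j : 'I_M) : (M <= expn 2 n)%N -> i != j ->
  exists2 p : 'I_n * bool,
    i \notin bit_class M p.1 p.2 & j \in bit_class M p.1 p.2.
Proof.
move=> leMn neij.
have [/existsP[b neb]|/existsPn eqb] :=
    boolP [exists b : 'I_n, odd (i %/ expn 2 b) != odd (j %/ expn 2 b)].
  by exists (b, odd (j %/ expn 2 b)); rewrite !inE.
case/eqP: neij; apply/val_inj/(@eq_from_bits n);
  rewrite ?(leq_trans (ltn_ord _)) // => b ltbn.
by apply/eqP; have := eqb (Ordinal ltbn); rewrite negbK.
Qed.

Lemma dec_errE n M rw (C : code n M) i e : dec_err rw C i e
  = [exists j, (C j != C i) && light (rw * INR n) (addw (C j) (addw (C i) e))].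
Proof. by apply: eq_existsb => j; rewrite hdistE. Qed.

(** Each wrongly decoded index is charged to a class that separates it from the index of a confusing
    codeword; there are [2 * n] classes. *)
Lemma dec_err_count n M rw (C : code n M) S v e (t : R) :
  (M <= expn 2 n)%N ->
  (forall p : 'I_n * bool, \big[Rplus/0]_(i : 'I_M)
    indic (hit (rw * INR n) S v e (bit_class M p.1 p.2) C C i) <= t) ->
  \big[Rplus/0]_(i : 'I_M) indic (agree S v (C i) && dec_err rw C i e)
    <= 2 * INR n * t.
Proof.
move=> leMn lehit.
apply: Rle_trans (_ : \big[Rplus/0]_(p : 'I_n * bool) t <= _); last first.
  right; rewrite sumR_const (_ : #|_| = (n * 2)%N) ?mult_INR /=; first ring.
  by rewrite -card_bool -[n in RHS]card_ord -card_prod; apply: eq_card.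
apply: Rle_trans (leR_sum _ (fun p _ => lehit p)).
rewrite exchange_big /=; apply: leR_sum => i _.
rewrite {1}/indic; case: ifP => [|_]; last first.
  by apply: sumR_ge0 => p _; exact: indic_ge0.
case/andP=> agr; rewrite dec_errE => /existsP[j /andP[neC lj]].
have neij : i != j by apply: contraNneq neC => ->.
have [p ip jp] := bit_classes_separate leMn neij.
rewrite (bigD1 p) //= (_ : hit _ _ _ _ _ _ _ i); last first.
  by rewrite /hit ip agr; apply/exists_inP; exists j.
set u := \big[_/_]_(_ | _) _; suff : 0 <= u by rewrite /indic; lra.
by apply: sumR_ge0 => k _; exact: indic_ge0.
Qed.

(** The error law is constant on each subcube, so the transmitted word may be replaced by its
    pattern [v], and for fixed [v] an average over [e] is at most the bound valid for every [e]. *)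
Lemma err_prob_le n M rw (C : code n M) S A (t : R) :
  (0 < M)%N -> (M <= expn 2 n)%N -> adversary rw S A ->
  (forall v e (p : 'I_n * bool), \big[Rplus/0]_(i : 'I_M)
    indic (hit (rw * INR n) S v e (bit_class M p.1 p.2) C C i) <= t) ->
  err_prob rw C A <= 2 * INR n * t / (density S * INR M).
Proof.
move=> M0 leMn [A0 [A1 [_ AS]]] lehit.
have M0R : 0 < INR M by apply/lt_0_INR/ltP.
have pow2 k : 0 < 2 ^ k by apply: pow_lt; lra.
pose F x i := \big[Rplus/0]_(e : word n) (A x e * indic (dec_err rw C i e)).
have -> : err_prob rw C A = (\big[Rplus/0]_i F (C i) i) / INR M.
  rewrite /err_prob /Rdiv (@big_distrl _ _ Rmult Rplus) /=.
  by apply: eq_bigr => i _; rewrite /F (@big_distrl _ _ Rmult Rplus).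
set s := \big[_/_]_i F (C i) i.
suff le : s * 2 ^ #|~: S| <= 2 ^ n * (2 * INR n * t).
  have -> : 2 * INR n * t / (density S * INR M)
      = (2 ^ n * (2 * INR n * t)) / 2 ^ #|~: S| / INR M.
    rewrite /density.
    move: (2 ^ _) (pow2 #|~: S|) (2 ^ n) (pow2 n) => K K0 N N0.
    by field; repeat split; lra.
  apply: Rmult_le_compat_r; first exact/Rlt_le/Rinv_0_lt_compat.
  apply: (Rmult_le_reg_r (2 ^ #|~: S|)) => //.
  rewrite /Rdiv Rmult_assoc Rinv_l ?Rmult_1_r //.
  by apply: Rgt_not_eq; exact: pow2.
have -> : 2 ^ n * (2 * INR n * t)
    = \big[Rplus/0]_(v : word n) (2 * INR n * t).
  by rewrite sumR_const -INR_card_word.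
rewrite /s (@big_distrl _ _ Rmult Rplus) /=.
(* Every codeword agrees on [S] with exactly [2 ^ #|~: S|] words [v], and [A] takes the same value
   at all of them. *)
have -> : \big[Rplus/0]_i (F (C i) i * 2 ^ #|~: S|) = \big[Rplus/0]_(v : word n)
    \big[Rplus/0]_(i : 'I_M) (indic (agree S v (C i)) * F v i).
  rewrite exchange_big /=; apply: eq_bigr => i _.
  rewrite -(card_agree S (C i)) (@big_distrr _ _ Rmult Rplus) /=.
  apply: eq_bigr => v _; rewrite agree_sym Rmult_comm.
  case: (boolP (agree _ _ _)) => [agr|_]; last by rewrite !Rmult_0_l.
  congr (_ * _); rewrite /F (AS (C i) v) // => k kS.
  by apply/esym/eqP; exact: (forall_inP agr).
apply: leR_sum => v _.
apply: Rle_trans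
  (_ : \big[Rplus/0]_(e : word n) (A v e * (2 * INR n * t)) <= _).
  rewrite /F.
  under eq_bigr => i _ do rewrite (@big_distrr _ _ Rmult Rplus) /=.
  rewrite exchange_big /=; apply: leR_sum => e _.
  apply: Rle_trans (Rmult_le_compat_l _ _ _ (A0 v e)
    (dec_err_count leMn (lehit v e))).
  rewrite (@big_distrr _ _ Rmult Rplus) /=; apply: leR_sum => i _.
  by rewrite /indic; case: agree; case: dec_err => /=; right; ring.
by rewrite -(@big_distrl _ _ Rmult Rplus) /= A1 Rmult_1_l; exact: Rle_refl.
Qed.

(** * Entropy bound for the volume of a ball *)

Lemma h_ln2 p : h p * ln 2 = - p * ln p - (1 - p) * ln (1 - p).
Proof. by rewrite /h /log2; field; have := ln_lt_2; lra. Qed.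

(* The words of weight at most [p n] have total mass at most 1 for the product
   Bernoulli(p) measure, and each has mass at least [2 ^ (- h p * n)]. *)
Lemma vol_le_entropy n p : 0 < p < 1 / 2 ->
  vol n (p * INR n) <= Rpower 2 (h p * INR n).
Proof.
move=> p12; pose w (b : bool) := if b then ln p else ln (1 - p).
apply: (Rmult_le_reg_r (exp (- (h p * ln 2 * INR n)))); first exact: exp_pos.
have -> : Rpower 2 (h p * INR n) * exp (- (h p * ln 2 * INR n)) = 1.
  by rewrite /Rpower -exp_plus -exp_0; congr exp; ring.
have <- : \big[Rplus/0]_(z : word n) \big[Rmult/1]_(i < n) exp (w (z i)) = 1.
  rewrite -(bigA_distr_bigA (times := Rmult) (plus := Rplus)
    (fun (i : 'I_n) b => exp (w b))) /=.
  apply: big1 => i _.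
  by rewrite big_bool /w /= !exp_ln; lra.
rewrite /vol (@big_distrl _ _ Rmult Rplus) /=; apply: leR_sum => z _.
rewrite -exp_sum /indic; case: lightP => [lez|_]; last first.
  by rewrite Rmult_0_l; exact/Rlt_le/exp_pos.
rewrite Rmult_1_l; apply: exp_le; rewrite h_ln2.
have -> : \big[Rplus/0]_(i < n) w (z i)
    = INR n * ln (1 - p) + INR (wt z) * (ln p - ln (1 - p)).
  have -> : INR (wt z) = \big[Rplus/0]_(i < n) indic (z i).
    by rewrite /wt card_indic; apply: eq_bigr => i _; rewrite inE.
  have -> : INR n * ln (1 - p) = \big[Rplus/0]_(i < n) ln (1 - p).
    by rewrite sumR_const -{1}(card_ord n).
  rewrite (@big_distrl _ _ Rmult Rplus) /= -big_split /=.
  by apply: eq_bigr => i _; rewrite /w /indic; case: (z i); ring.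
(* As [p < 1 / 2], the mass of a word decreases with its weight, so weight [p * n] is the worst
   case. *)
have : ln p < ln (1 - p) by apply: ln_increasing; lra.
nra.
Qed.

(** * Failure probability of a random code *)

(** To be used with [a = 2^(-eps n / 2)]; [mu] is the expected number of codewords showing the
    pattern [v]. *)
Lemma hit_tail_small n M (r a : R) S v e (J : {set 'I_M}) :
  0 <= r -> 0 < a <= / 16 -> INR M * vol n r <= 2 ^ n * (a * a) ->
  / (2 * (a * a)) <= INR M * density S ->
  prob [set C : code n M | pbool (INR M * density S * a
      <= \big[Rplus/0]_(i : 'I_M) indic (hit r S v e J C C i))]
    <= 2 * exp (- / (8 * a)).
Proof.
move=> r0 a0 Mvol; set mu := INR M * density S => mu_ge.
(* With [s = 4 * mu] the first exponent is [- mu]. With [t = mu * a] the second is at most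
   [4 mu a^2 - mu a / 2], hence at most [- mu a / 4] because [a <= / 16]. Both are at most
   [- / (8 * a)]. *)
have := hit_tail S v e J (4 * mu) (mu * a) r0; rewrite -/mu => tail.
have mua : / (8 * a) <= mu * a / 4.
  have -> : / (8 * a) = / (2 * (a * a)) * (a / 4) by field; lra.
  have -> : mu * a / 4 = mu * (a / 4) by field.
  by apply: Rmult_le_compat_r; lra.
have mu0 : 0 < mu.
  by apply: Rlt_le_trans mu_ge; apply: Rinv_0_lt_compat; nra.
have pow2 : 0 < 2 ^ n by apply: pow_lt; lra.
have MvolN : INR M * (4 * mu * vol n r / 2 ^ n) <= 4 * mu * (a * a).
  have -> : INR M * (4 * mu * vol n r / 2 ^ n)
      = 4 * mu * (INR M * vol n r / 2 ^ n) by rewrite /Rdiv; ring.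
  apply: Rmult_le_compat_l; first lra.
  apply: (Rmult_le_reg_r (2 ^ n)) => //.
  by rewrite /Rdiv Rmult_assoc Rinv_l; lra.
apply: Rle_trans tail _.
have -> : 2 * exp (- / (8 * a)) = exp (- / (8 * a)) + exp (- / (8 * a)) by ring.
apply: Rplus_le_compat; apply: exp_le; last first.
  have : mu * a * a <= mu * a * / 16 by apply: Rmult_le_compat_l; nra.
  by lra.
have : / (8 * a) <= / (2 * (a * a)) by apply: Rinv_le_contravar; nra.
lra.
Qed.

Lemma prob_not_good_le n M (rr rw a : R) :
  (0 < M)%N -> (M <= expn 2 n)%N ->
  0 <= rw * INR n -> 0 < a <= / 16 ->
  INR M * vol n (rw * INR n) <= 2 ^ n * (a * a) ->
  (forall S : {set 'I_n}, INR #|S| <= rr * INR n ->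
    / (2 * (a * a)) <= INR M * density S) ->
  prob (~: [set C : code n M | pbool (good rr rw (2 * INR n * a) C)])
    <= 2 ^ n * 2 ^ n * 2 ^ n * INR n * 4 * exp (- / (8 * a)).
Proof.
move=> M0 leMn r0 a0 Mvol dens.
have M0R : 0 < INR M by apply/lt_0_INR/ltP.
pose K : finType := ({set 'I_n} * word n * word n * ('I_n * bool))%type.
pose overflow (S : {set 'I_n}) v e (p : 'I_n * bool) (C : code n M) :=
  INR M * density S * a <= \big[Rplus/0]_(i : 'I_M)
    indic (hit (rw * INR n) S v e (bit_class M p.1 p.2) C C i).
(* Read sets that are too large get the empty event, so the union can run over all subsets. *)
pose B (k : K) := let: (Q, v, e, p) := k in
  [set C | pbool (INR #|Q| <= rr * INR n /\ overflow Q v e p C)].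
have -> : 2 ^ n * 2 ^ n * 2 ^ n * INR n * 4 * exp (- / (8 * a))
    = INR #|K| * (2 * exp (- / (8 * a))).
  rewrite /K !card_prod card_bool !mult_INR INR_card_word card_ord.
  rewrite -cardsT -powersetT card_powerset cardsT card_ord INR_expn.
  by rewrite (_ : INR 2 = 2) //; ring.
apply: (@prob_union_bound _ _ _ B) => [C|[[[Q v] e] p]]; last first.
  have [leS|ltS] := Rle_dec (INR #|Q|) (rr * INR n).
    apply: Rle_trans
      (hit_tail_small v e (bit_class M p.1 p.2) r0 a0 Mvol (dens _ leS)).
    by apply: prob_sub; apply/subsetP => C; rewrite !inE => /pboolP[_ /pboolP].
  rewrite (_ : B _ = set0); last first.
    by apply/setP => C; rewrite !inE; apply/pboolP => -[].
  rewrite /prob cards0 /Rdiv Rmult_0_l.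
  by have := exp_pos (- / (8 * a)); lra.
rewrite !inE => /pboolP nogood; apply/existsP; apply: contraT => /existsPn nB.
case: nogood => S leS A advA.
have dens0 : 0 < density S.
  by apply: Rmult_lt_0_compat; [|apply: Rinv_0_lt_compat]; apply: pow_lt; lra.
have -> : 2 * INR n * a
    = 2 * INR n * (INR M * density S * a) / (density S * INR M).
  by field; lra.
apply: err_prob_le => // v e p; apply/Rlt_le/Rnot_le_lt => over.
by have := nB (S, v, e, p); rewrite inE => /pboolP; apply.
Qed.

(** * Numerical estimates *)

Lemma pow2_exp k : 2 ^ k = exp (INR k * ln 2).
Proof. by rewrite -Rpower_pow ?/Rpower //; lra. Qed.

(** The hypothesis makes the power at least 2, so rounding down loses at most half of it. *)
Lemma ncode_bounds Rate n : 1 <= Rate * INR n ->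
  Rpower 2 (Rate * INR n) / 2 <= INR (ncode Rate n) <= Rpower 2 (Rate * INR n).
Proof.
move=> Rn; rewrite /ncode; set x := Rpower 2 _.
have x2 : 2 <= x.
  by rewrite -(Rpower_1 2); [apply: Rle_Rpower|]; lra.
have [le gt] := base_Int_part x.
have z0 : (0 <= Int_part x)%Z by apply: le_IZR; lra.
by rewrite INR_IZR_INZ Z2Nat.id //; lra.
Qed.

Lemma density_ge n (rr : R) (S : {set 'I_n}) : INR #|S| <= rr * INR n ->
  Rpower 2 (- (rr * INR n)) <= density S.
Proof.
move=> leS; have -> : density S = 2 ^ #|~: S| / (2 ^ #|S| * 2 ^ #|~: S|).
  by rewrite -pow_add plusE cardsC card_ord.
have p1 : 0 < 2 ^ #|S| by apply: pow_lt; lra.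
have p2 : 0 < 2 ^ #|~: S| by apply: pow_lt; lra.
have -> : 2 ^ #|~: S| / (2 ^ #|S| * 2 ^ #|~: S|) = / 2 ^ #|S| by field; lra.
rewrite Rpower_Ropp; apply: Rinv_le_contravar => //.
by rewrite pow2_exp; apply: exp_le; have := ln_lt_2; nra.
Qed.

Lemma exp_ge_sqr x : 0 <= x -> x * x / 4 <= exp x.
Proof.
move=> x0; have -> : exp x = exp (x / 2) * exp (x / 2).
  by rewrite -exp_plus; congr exp; field.
by have := exp_ineq1_le (x / 2); nra.
Qed.

(** The prefactor is at most [exp (4 n + 2)], and [4 n + 2 - 7 n <= - n] once [n >= 1]. Here [E]
    stands for [/ a]. *)
Lemma failure_exponent n E : 7 * INR n <= E / 8 -> (0 < n)%N ->
  2 ^ n * 2 ^ n * 2 ^ n * INR n * 4 * exp (- (E / 8)) <= / INR n.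
Proof.
move=> leE n0; have n1 : 1 <= INR n by apply: (le_INR 1); apply/leP.
have e1 := exp_ineq1_le 1.
have e4 : 4 <= exp 2 by have -> : 2 = 1 + 1 by []; rewrite exp_plus; nra.
have en : INR n <= exp (INR n) by have := exp_ineq1_le (INR n); lra.
have pown : 2 ^ n <= exp (INR n).
  rewrite pow2_exp; apply: exp_le.
  have := exp_ineq1_le (ln 2); rewrite exp_ln; last lra.
  by nra.
have pow0 : 0 <= 2 ^ n by apply: pow_le; lra.
apply: Rle_trans (_ : exp (INR n) * exp (INR n) * exp (INR n) * exp (INR n)
    * exp 2 * exp (- (E / 8)) <= _).
  apply: Rmult_le_compat_r; first exact/Rlt_le/exp_pos.
  by repeat apply: Rmult_le_compat; rewrite //; try lra;
    repeat apply: Rmult_le_pos; rewrite //; lra.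
rewrite -!exp_plus; apply: Rle_trans (_ : exp (- INR n) <= _).
  by apply: exp_le; lra.
by rewrite exp_Ropp; apply: Rinv_le_contravar; lra.
Qed.

Lemma Un_cv_of_inv_bound (u : nat -> R) (l k x : R) :
  (forall n, (0 < n)%N -> x <= INR n -> Rabs (u n - l) <= k / INR n) ->
  Un_cv u l.
Proof.
move=> le d d0.
have [N gtN] := INR_unbounded (Rmax (Rmax x 0) (k / d)).
exists N => n /le_INR leN.
have := Rmax_l (Rmax x 0) (k / d); have := Rmax_r (Rmax x 0) (k / d).
have := Rmax_l x 0; have := Rmax_r x 0 => ? ? ? ?.
have n0 : 0 < INR n by lra.
rewrite /R_dist; apply: Rle_lt_trans (le n _ _) _; last 1 first.
- apply: (Rmult_lt_reg_r (INR n)) => //.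
  rewrite /Rdiv Rmult_assoc Rinv_l ?Rmult_1_r; last lra.
  have -> : k = k / d * d by field; lra.
  by rewrite (Rmult_comm d); apply: Rmult_lt_compat_r; lra.
- by apply/ltP/INR_lt.
- by lra.
Qed.

(** * Choice of parameters and passage to the limit *)

Unset Implicit Arguments.

Theorem theorem4p5 (rr rw eps : R)
  (hrr : (0 < rr < 1)) (hrw : (0 < rw < 1/2)) (heps : (0 < eps))
  (hlt : (rr < 1 - h rw - 2 * eps)) :
  exists delta : nat -> R,
    Un_cv delta 0 /\
    Un_cv (fun n => prob_good rr rw (1 - h rw - eps) n (delta n)) 1.
Proof.
have ln2 := ln_lt_2; pose c := eps * ln 2 / 2.
have c0 : 0 < c by rewrite /c; nra.
pose a n := exp (- (c * INR n)).
have a0 n : 0 < a n by exact: exp_pos.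
have inva n : / a n = exp (c * INR n) by rewrite /a exp_Ropp Rinv_inv.
have inva_ge n : c * c * INR n * INR n / 4 <= / a n.
  rewrite inva; have := pos_INR n => n0.
  have -> : c * c * INR n * INR n / 4 = (c * INR n) * (c * INR n) / 4 by field.
  by apply: exp_ge_sqr; nra.
exists (fun n => 2 * INR n * a n); split.
  (* The quadratic bound [a n <= 4 / (c^2 n^2)] turns [2 n a n] into at most [8 / (c^2 n)]. *)
  apply: (@Un_cv_of_inv_bound _ _ (8 / (c * c)) 0) => n /ltP/lt_0_INR n0 _.
  have cc : 0 < c * c by nra.
  have := inva_ge n; rewrite Rminus_0_r Rabs_pos_eq; last first.
    by apply: Rmult_le_pos; [lra | exact: Rlt_le].
  move=> le; apply: (Rmult_le_reg_r (/ a n)); first exact: Rinv_0_lt_compat.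
  rewrite Rmult_assoc Rinv_r; last by have := a0 n; lra.
  have -> : 2 * INR n * 1
      = 8 / (c * c) / INR n * (c * c * INR n * INR n / 4).
    by field; split; lra.
  apply: Rmult_le_compat_l => //.
  apply: Rmult_le_pos; last by apply/Rlt_le/Rinv_0_lt_compat.
  by apply/Rlt_le/Rdiv_lt_0_compat; lra.
(* The term with 224 = 4 * 56 gives [/ a n >= 56 n], as [failure_exponent] requires, and also
   [a n <= / 16]. The term [/ rr] gives [rr * n >= 1], hence [Rate * n >= 1] since [Rate > rr]. *)
apply: (@Un_cv_of_inv_bound _ _ 1 (224 / (c * c) + 1 + / rr)) => n n0 len.
have cc : 0 < c * c by nra.
have irr : 0 < / rr by apply: Rinv_0_lt_compat; lra.
have i224 : 0 < 224 / (c * c) by apply: Rdiv_lt_0_compat; lra.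
have n1 : 1 <= INR n by lra.
have rrn : 1 <= rr * INR n.
  rewrite -(Rinv_r rr); last lra.
  by apply: Rmult_le_compat_l; lra.
have ccn : 224 <= c * c * INR n.
  have -> : 224 = c * c * (224 / (c * c)) by field; lra.
  by apply: Rmult_le_compat_l; lra.
pose Rate := 1 - h rw - eps; pose M := ncode Rate n.
have [geM leM] : Rpower 2 (Rate * INR n) / 2 <= INR M
    <= Rpower 2 (Rate * INR n).
  by apply: ncode_bounds; rewrite /Rate; nra.
have E : a n * a n = Rpower 2 (- (eps * INR n)).
  by rewrite /a /Rpower -exp_plus; congr exp; rewrite /c; field.
have word0 : (0 < #|{: code n M}|)%N.
  by apply/card_gt0P; exists [ffun=> [ffun=> false]].
have a16 : 0 < a n <= / 16.
  split => //; rewrite -(Rinv_inv (a n)); apply: Rinv_le_contravar; first lra.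
  have := inva_ge n.
  have : 224 * 1 <= c * c * INR n * INR n by apply: Rmult_le_compat; lra.
  by lra.
have r0 : 0 <= rw * INR n by nra.
have Mvol : INR M * vol n (rw * INR n) <= 2 ^ n * (a n * a n).
  have -> : 2 ^ n * (a n * a n)
      = Rpower 2 (Rate * INR n) * Rpower 2 (h rw * INR n).
    rewrite E pow2_exp /Rpower -!exp_plus; congr exp; rewrite /Rate; ring.
  apply: Rmult_le_compat; [exact: pos_INR | | exact: leM |].
    by have := @vol_ge1 n _ r0; lra.
  exact: vol_le_entropy.
have M0 : (0 < M)%N.
  apply/ltP/INR_lt; apply: Rlt_le_trans geM.
  by apply: Rdiv_lt_0_compat; [exact: exp_pos | lra].
(* A ball has at least one word, so [Mvol] already bounds [M] itself. *)
have leMn : (M <= expn 2 n)%N.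
  apply/leP/INR_le; rewrite INR_expn (_ : INR 2 = 2) //.
  have pow0 : 0 <= 2 ^ n by apply: pow_le; lra.
  have aa : a n * a n <= 1 by nra.
  have := Rmult_le_compat_l _ _ _ (pos_INR M) (@vol_ge1 n _ r0).
  by have := Rmult_le_compat_l _ _ _ pow0 aa; lra.
(* The hypothesis on [rr] leaves [Rate - rr > eps], so at least [2^(eps n) / 2] codewords are
   expected per pattern. *)
have dens (S : {set 'I_n}) : INR #|S| <= rr * INR n ->
    / (2 * (a n * a n)) <= INR M * density S.
  move=> /density_ge geS.
  apply: Rle_trans (Rmult_le_compat _ _ _ _ _ _ geM geS).
  - have -> : / (2 * (a n * a n)) = Rpower 2 (eps * INR n) / 2.
      by rewrite Rinv_mult E -Rpower_Ropp Ropp_involutive; field.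
    rewrite (_ : _ / 2 * _ = Rpower 2 (Rate * INR n - rr * INR n) / 2).
      rewrite /Rdiv; apply: Rmult_le_compat_r; first lra.
      by apply: Rle_Rpower; rewrite /Rate; nra.
    by rewrite Rpower_plus; field.
  - by apply/Rlt_le/Rdiv_lt_0_compat; [exact: exp_pos | lra].
  - exact/Rlt_le/exp_pos.
have fail := prob_not_good_le M0 leMn r0 a16 Mvol dens.
have a8 : / (8 * a n) = / a n / 8 by field; have := a0 n; lra.
have le1 : prob (~: [set C : code n M | pbool (good rr rw (2 * INR n * a n) C)])
    <= / INR n.
  apply: Rle_trans fail _; rewrite a8; apply: failure_exponent => //.
  have := inva_ge n.
  have : 224 * INR n <= c * c * INR n * INR n by apply: Rmult_le_compat_r; lra.
  by lra.
have -> : prob_good rr rw (1 - h rw - eps) n (2 * INR n * a n)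
    = prob [set C : code n M | pbool (good rr rw (2 * INR n * a n) C)] by [].
rewrite prob_setC //.
set q := prob _ in le1 *.
have q0 : 0 <= q by apply: Rmult_le_pos; [exact: pos_INR | exact: Rinv_INR_ge0].
rewrite (_ : 1 - q - 1 = - q); last ring.
by rewrite Rabs_Ropp Rabs_pos_eq; lra.
Qed.
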